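(* Let $R$ be a field of zero characteristic and let $n\geq 3$ be an integer. Then the Reidemeister spectrum of the group $\mathrm{UT}_n(R)$ of upper unitriangular $n\times n$ matrices over $R$ is $\{1,\infty\}$, i.e. $\{R(\varphi)\mid \varphi\in\mathrm{Aut}(\mathrm{UT}_n(R))\}=\{1,\infty\}$.
   Context: $\mathrm{UT}_n(R)$ is the group (under matrix multiplication) of $n\times n$ matrices over $R$ with $1$ on the diagonal, $0$ below the diagonal and arbitrary entries above the diagonal. For a group $G$ and a group automorphism $\varphi$ of $G$, elements $x,y\in G$ are $\varphi$-conjugated if there is $z\in G$ with $x=zy\varphi(z)^{-1}$; this is an equivalence relation, and the number $R(\varphi)\in\mathbb{N}\cup\{\infty\}$ of its equivalence classes is the Reidemeister number of $\varphi$ (all infinite cardinalities are recorded as $\infty$). The Reidemeister spectrum of $G$ is the set $\{R(\varphi)\mid\varphi\in\mathrm{Aut}(G)\}\subseteq\mathbb{N}\cup\{\infty\}$, where $\mathrm{Aut}(G)$ is the group of all group automorphisms of $G$. *)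

(* Defs.v *)
From HB Require Import structures.
From mathcomp Require Import all_boot all_order all_algebra.
From mathcomp Require Import finmap boolp classical_sets cardinality.

Set Implicit Arguments.
Unset Strict Implicit.
Unset Printing Implicit Defensive.

Import GRing.Theory.

Section Unitriangular.
Variables (R : comUnitRingType) (n : nat).
Local Open Scope ring_scope.

(* [is_trig_mx] of the library is lower triangularity, hence this predicate *)
Definition unitriangular (A : 'M[R]_n) : bool :=
  [forall i : 'I_n, forall j : 'I_n, (j <= i)%N ==> (A i j == (i == j)%:R)].

Lemma unitriangularP (A : 'M[R]_n) :
  reflect (forall i j : 'I_n, (j <= i)%N -> A i j = (i == j)%:R)
          (unitriangular A).
Proof.
apply: (iffP forallP) => [h i j ji | h i].
  by apply/eqP; move/forallP/(_ j)/implyP: (h i); apply.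
by apply/forallP => j; apply/implyP => ji; apply/eqP/h.
Qed.

Record UT := MkUT { UT_mx : 'M[R]_n; UT_mxP : unitriangular UT_mx }.

HB.instance Definition _ := [isSub for UT_mx].
HB.instance Definition _ := [Choice of UT by <:].

Lemma unitriangular1 : unitriangular 1%:M.
Proof. by apply/unitriangularP => i j _; rewrite mxE. Qed.

Lemma unitriangularM (A B : 'M[R]_n) :
  unitriangular A -> unitriangular B -> unitriangular (A *m B).
Proof.
move=> /unitriangularP hA /unitriangularP hB; apply/unitriangularP => i j ji.
rewrite mxE (bigD1 i) //= hA // eqxx mul1r hB // big1 ?addr0 // => k ki.
have [lt_ki|le_ik] := ltnP k i.
  by rewrite (hA i k (ltnW lt_ki)) eq_sym (negbTE ki) mul0r.
have lt_ik : (i < k)%N by rewrite ltn_neqAle eq_sym [_ == _](negbTE ki).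
rewrite (hB k j (leq_trans ji le_ik)) [k == j](_ : _ = false) ?mulr0 //.
by apply/negbTE; rewrite -val_eqE /= neq_ltn (leq_ltn_trans ji lt_ik) orbT.
Qed.

Lemma unitriangular_unit (A : 'M[R]_n) : unitriangular A -> A \in unitmx.
Proof.
move=> /unitriangularP hA; rewrite unitmxE -det_tr det_trig.
  by rewrite big1 ?unitr1 // => i _; rewrite mxE hA ?eqxx.
apply/is_trig_mxP => i j ij; rewrite mxE hA 1?ltnW //.
by rewrite -val_eqE /= gtn_eqF.
Qed.

Lemma unitriangularV (A : 'M[R]_n) :
  unitriangular A -> unitriangular (invmx A).
Proof.
move=> uA; have := mulVmx (unitriangular_unit uA).
move: (invmx A) => B BA; move/unitriangularP: uA => hA.
apply/unitriangularP => i j; have [m] := ubnP (nat_of_ord j).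
elim: m j => // m IHm j; rewrite ltnS => jm ji.
have := congr1 (fun M : 'M[R]_n => M i j) BA; rewrite !mxE => <-.
rewrite (bigD1 j) //= hA // eqxx mulr1 big1 ?addr0 // => k kj.
have [lt_kj|le_jk] := ltnP k j; last by rewrite (hA k j le_jk) (negbTE kj) mulr0.
have lt_ki := leq_trans lt_kj ji.
rewrite IHm ?(leq_trans lt_kj) ?(ltnW lt_ki) //.
by rewrite -val_eqE /= gtn_eqF // mul0r.
Qed.

Definition UT_one : UT := MkUT unitriangular1.
Definition UT_mul (A B : UT) : UT := MkUT (unitriangularM (UT_mxP A) (UT_mxP B)).
Definition UT_inv (A : UT) : UT := MkUT (unitriangularV (UT_mxP A)).

Lemma UT_mulA : associative UT_mul.
Proof. by move=> A B C; apply: val_inj; rewrite /= mulmxA. Qed.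
Lemma UT_mul1 : left_id UT_one UT_mul.
Proof. by move=> A; apply: val_inj; rewrite /= mul1mx. Qed.
Lemma UT_1mul : right_id UT_one UT_mul.
Proof. by move=> A; apply: val_inj; rewrite /= mulmx1. Qed.
Lemma UT_mulV : left_inverse UT_one UT_inv UT_mul.
Proof.
by move=> A; apply: val_inj; rewrite /= mulVmx // unitriangular_unit ?UT_mxP.
Qed.
Lemma UT_Vmul : right_inverse UT_one UT_inv UT_mul.
Proof.
by move=> A; apply: val_inj; rewrite /= mulmxV // unitriangular_unit ?UT_mxP.
Qed.

HB.instance Definition _ :=
  isGroup.Build UT UT_mulA UT_mul1 UT_1mul UT_mulV UT_Vmul.

End Unitriangular.

Section Reidemeister.
Variable G : groupType.
Local Open Scope group_scope.
Local Open Scope classical_set_scope.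

Definition twisted_conj (phi : G -> G) (x y : G) : Prop :=
  exists z : G, x = z * y * (phi z)^-1.

Definition twisted_classes (phi : G -> G) : set (set G) :=
  [set C | exists x : G, C = [set y | twisted_conj phi y x]].

(* Values in the natural numbers extended by infinity: [Some k] is the finite
   number k, [None] is infinity. *)
Definition reidemeister_number (phi : G -> G) : option nat :=
  if `[< finite_set (twisted_classes phi) >]
  then Some #|` fset_set (twisted_classes phi)| else None.

Definition reidemeister_spectrum : set (option nat) :=
  [set r | exists2 phi : {multiplicative G -> G},
             bijective phi & r = reidemeister_number phi].

End Reidemeister.

(* Main.v *)
Require Import Defs.
From HB Require Import structures.
From mathcomp Require Import all_boot all_order all_algebra.
From mathcomp Require Import finmap boolp classical_sets cardinality.
From mathcomp Require Import ring.

(** The classification of the automorphisms of the unitriangular group can be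
    bypassed: the dichotomy holds for every nilpotent group G in which each
    element has, for each m > 0, exactly one m-th root (a Malcev complete, or
    rationally powered, group).

    Let phi be an endomorphism of such a G with finitely many twisted classes,
    and let Z_k be the upper central series, whose quotients G / Z_k again have
    unique roots ([upper_cong_root_inj]).  Suppose
    that x lies in Z_(k+1).  Two powers of x are twisted conjugate, so some
    positive power x^m equals g phi(g)^-1 modulo Z_k, where g and phi(g) agree
    modulo Z_(k+1).  So do h and phi(h) for the m-th root h of g, by uniqueness
    of roots, and on the group of such h the map h |-> h phi(h)^-1 is a morphism
    to the torsion-free group Z_(k+1) / Z_k.  Hence h phi(h)^-1 = x modulo Z_k:
    the image of that morphism is a divisible subgroup of finite index in a
    vector space over the rationals, so it is everything.  Thus x is twisted
    conjugate to an element of Z_k ([twisted_conj_descent]), and descending to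
    Z_0 = 1 shows that there is only one class ([twisted_conj1]).

    In UT_n(R) everything follows from the filtration of matrices by the number
    of vanishing diagonals ([band]).  It gives nilpotency.  If x and y agree up
    to the d-th diagonal, then y^m - x^m = m (y - x) up to the next one, which
    is where characteristic zero enters: roots are unique, and they exist by
    correcting one diagonal at a time ([UT_successive_approximation]).

    Both values occur.  Conjugation by diag(1, ..., n) multiplies the entry
    (i, j) by a scalar other than 1 when i < j, so z = x phi(z) can be solved
    diagonal by diagonal, and the number is 1.  For the identity a finite number
    would make every element conjugate to 1, hence equal to 1. *)

Import GRing.Theory.

Local Open Scope classical_set_scope.

(** * Morphisms of groups *)

Section GroupMorphisms.
Variables (G H : groupType) (f : {multiplicative G -> H}).
Local Open Scope group_scope.

Lemma multiplicative1 : f 1 = 1.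
Proof. by apply: (mulgI (f 1)); rewrite -gmulfM !mulg1. Qed.

Lemma multiplicativeV x : f x^-1 = (f x)^-1.
Proof. by apply/divg1_eq; rewrite invgK -gmulfM mulVg multiplicative1. Qed.

Lemma multiplicativeX x m : f (x ^+ m) = f x ^+ m.
Proof.
elim: m => [|m IHm]; first exact: multiplicative1.
by rewrite !expgS gmulfM IHm.
Qed.

End GroupMorphisms.

(** * Congruences modulo the upper central series *)

Section UpperCentralCongruence.
Variable G : groupType.
Implicit Types (x y z g h u w : G) (k m : nat).
Local Open Scope group_scope.

(** Congruence modulo the k-th term Z_k of the upper central series: as
    Z_(k+1) / Z_k is the kernel of the action of G on G / Z_k by conjugation,
    x and y agree modulo Z_(k+1) when they act in the same way modulo Z_k.  This
    form avoids forming the subgroups and the quotients. *)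
Fixpoint upper_cong k x y : Prop :=
  if k is k'.+1 then forall g, upper_cong k' (g ^ x) (g ^ y) else x = y.

Lemma upper_cong_refl k x : upper_cong k x x.
Proof. by elim: k x => //= k IHk x g. Qed.

Lemma upper_cong_sym {k x y} : upper_cong k x y -> upper_cong k y x.
Proof. by elim: k x y => //= k IHk x y xy g; apply: IHk. Qed.

Lemma upper_cong_trans {k} y {x z} :
  upper_cong k x y -> upper_cong k y z -> upper_cong k x z.
Proof.
elim: k x y z => /= [x y z -> //|k IHk x y z xy yz g].
exact: IHk (xy g) (yz g).
Qed.

Lemma upper_congM {k x y x' y'} :
  upper_cong k x y -> upper_cong k x' y' -> upper_cong k (x * x') (y * y').
Proof.
elim: k x y x' y' => /= [x y x' y' -> -> //|k IHk x y x' y' xy xy' g].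
rewrite !conjgM; apply: (upper_cong_trans ((g ^ x) ^ y')); first exact: xy'.
rewrite !(conjgE _ y'); apply: (IHk); first exact: upper_cong_refl.
by apply: IHk; [exact: xy | exact: upper_cong_refl].
Qed.

Lemma upper_congMl {k x y} z : upper_cong k x y -> upper_cong k (z * x) (z * y).
Proof. exact/upper_congM/upper_cong_refl. Qed.

Lemma upper_congMr {k x y} z : upper_cong k x y -> upper_cong k (x * z) (y * z).
Proof. by move/upper_congM; apply; apply: upper_cong_refl. Qed.

Lemma upper_congJ {k x y} g : upper_cong k x y -> upper_cong k (x ^ g) (y ^ g).
Proof. by move=> xy; rewrite !conjgE; apply/upper_congMl/upper_congMr. Qed.

Lemma upper_congV {k x y} : upper_cong k x y -> upper_cong k x^-1 y^-1.
Proof.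
case: k => [-> //|k] xy g.
(* Conjugate both sides of the congruence at g ^ x^-1 back by y. *)
have /(upper_congJ y^-1) := xy (g ^ x^-1).
by rewrite conjgKV conjgK => /upper_cong_sym.
Qed.

Lemma upper_congX {k x y} m :
  upper_cong k x y -> upper_cong k (x ^+ m) (y ^+ m).
Proof.
move=> xy; elim: m => [|m IHm]; first exact: upper_cong_refl.
by rewrite !expgS; apply: upper_congM.
Qed.

Lemma upper_congS {k x y} : upper_cong k x y -> upper_cong k.+1 x y.
Proof.
move=> xy g; rewrite !conjgE.
exact: upper_congM (upper_congV xy) (upper_congMl _ xy).
Qed.

(** This recovers the usual description of Z_(k+1) as the preimage of the center
    of G / Z_k. *)
Lemma upper_cong1P k u :
  upper_cong k.+1 u 1 <-> forall g, upper_cong k (u * g) (g * u).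
Proof.
split=> /= [u1 g | uC g].
  have /(upper_congMl u)/upper_cong_sym := u1 g.
  by rewrite conjg1 conjgE mulVKg.
by rewrite conjg1 conjgE -{2}[g](mulKg u); apply/upper_congMl/upper_cong_sym.
Qed.

Lemma upper_cong_div {k x y} :
  upper_cong k x y -> upper_cong k (x / y) 1.
Proof. by move/(upper_congMr y^-1); rewrite mulgV. Qed.

(** Elements of Z_(k+1) commute with everything modulo Z_k, so powers distribute
    over products with them. *)
Lemma upper_cong_expgMn {k u} x m : upper_cong k.+1 u 1 ->
  upper_cong k ((u * x) ^+ m) (u ^+ m * x ^+ m).
Proof.
move=> u1; elim: m => [|m IHm].
  by rewrite !expg0 mulg1; apply: upper_cong_refl.
rewrite !expgS; apply: upper_cong_trans (upper_congMl _ IHm) _.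
rewrite -!mulgA; apply: upper_congMl; rewrite !mulgA; apply: upper_congMr.
apply: upper_cong_sym; have := upper_congX m u1.
by rewrite expg1n => /upper_cong1P.
Qed.

Hypothesis divisibleG : forall m x, 0 < m -> exists y, y ^+ m = x.
Hypothesis root_inj : forall m x y, 0 < m -> x ^+ m = y ^+ m -> x = y.

(** Uniqueness of roots passes from G / Z_k to G / Z_(k+1).  If x^m = z y^m with
    z in Z_(k+1), then the root w of z lies in Z_(k+1) as well, since its
    conjugates are roots of conjugates of z, which equal z modulo Z_k; so x and
    w y have the same m-th power modulo Z_k. *)
Lemma upper_cong_root_inj k m x y : 0 < m ->
  upper_cong k (x ^+ m) (y ^+ m) -> upper_cong k x y.
Proof.
move=> m_gt0; elim: k x y => [|k IHk] x y; first exact: root_inj.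
move=> /upper_cong_div; set z := _ / _ => z1.
have [w wm] := divisibleG _ z m_gt0.
have w1 : upper_cong k.+1 w 1.
  apply/upper_cong1P => g; rewrite [w * g]conjgC; apply: upper_congMl.
  apply: IHk; rewrite -conjXg wm conjgE.
  have /upper_cong1P/(_ g)/(upper_congMl g^-1) := z1.
  by rewrite mulKg.
apply: (upper_cong_trans (w * y)); last first.
  by have := upper_congMr y w1; rewrite mul1g.
apply/upper_congS/IHk/upper_cong_sym.
by have := upper_cong_expgMn y m w1; rewrite wm mulgVK.
Qed.

(** * Twisted conjugacy in nilpotent groups with unique roots *)

Hypothesis nilpotentG : exists c, forall x y, upper_cong c x y.
Variable phi : {multiplicative G -> G}.

Lemma twisted_conj_refl x : twisted_conj phi x x.
Proof. by exists 1; rewrite mul1g multiplicative1 invg1 mulg1. Qed.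

Lemma twisted_conj_trans y x z :
  twisted_conj phi x y -> twisted_conj phi y z -> twisted_conj phi x z.
Proof.
by case=> a -> [b ->]; exists (a * b); rewrite gmulfM invgM !mulgA.
Qed.

(** Finitely many classes cannot separate the powers of x. *)
Lemma twisted_conj_power x : finite_set (twisted_classes phi) ->
  exists i m g, 0 < m /\ x ^+ (i + m) = g * x ^+ i * (phi g)^-1.
Proof.
move=> fin; pose cl i := [set y | twisted_conj phi y (x ^+ i)].
have [[i [j [ij clij]]]|inj] :=
  pselect (exists i j, (i < j)%N /\ cl i = cl j).
  have : cl i (x ^+ j) by rewrite clij; apply: twisted_conj_refl.
  case=> g xj; exists i, (j - i)%N, g.
  by rewrite subn_gt0 subnKC // ltnW.
have cl_inj : injective cl.
  move=> i j clij; case: (ltngtP i j) => // ij; case: inj.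
    by exists i, j.
  by exists j, i.
case: infinite_nat; have <- : cl @^-1` twisted_classes phi = [set: nat].
  by apply/seteqP; split=> // i _; exists (x ^+ i).
by apply: finite_preimage fin => i j _ _; apply: cl_inj.
Qed.

(** The subgroup of Z_(k+1) / Z_k formed by the g phi(g)^-1, where g and phi(g)
    agree modulo Z_(k+1), contains a positive power of x because the number of
    classes is finite.  It is divisible, by uniqueness of roots modulo Z_(k+1),
    so it contains x. *)
Lemma twisted_conj_descent k x : finite_set (twisted_classes phi) ->
    upper_cong k.+1 x 1 ->
  exists2 y, upper_cong k y 1 & twisted_conj phi x y.
Proof.
move=> fin x1; have [i [m [g [m_gt0 xim]]]] := twisted_conj_power x fin.
have [h hm] := divisibleG m g m_gt0.
have xi1 j : upper_cong k.+1 (x ^+ j) 1.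
  by have := upper_congX j x1; rewrite expg1n.
(* Modulo Z_k the central factor x^i cancels in x^(i+m) = g x^i phi(g)^-1. *)
have gphi : upper_cong k (g / phi g) (x ^+ m).
  have /(upper_congMr (phi g)^-1) := (upper_cong1P k (x ^+ i)).1 (xi1 i) g.
  rewrite -xim -mulgA expgnDr => /(upper_congMl (x ^+ i)^-1).
  by rewrite !mulKg.
pose u := h / phi h.
(* Modulo Z_(k+1), h and phi(h) are m-th roots of g and phi(g), which agree. *)
have u1 : upper_cong k.+1 u 1.
  apply: upper_cong_div; apply: (upper_cong_root_inj _ m) => //.
  rewrite -multiplicativeX hm.
  have := upper_cong_trans _ (upper_congS gphi) (xi1 m).
  by move/(upper_congMr (phi g)); rewrite mulgVK mul1g.
(* Both u^m and x^m are g phi(g)^-1 modulo Z_k. *)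
have ux : upper_cong k u x.
  apply: (upper_cong_root_inj _ m) => //; apply: upper_cong_trans gphi.
  have := upper_cong_expgMn (phi h) m u1.
  rewrite mulgVK -multiplicativeX hm => /(upper_congMr (phi g)^-1).
  by rewrite mulgK => /upper_cong_sym.
exists (h^-1 * x * phi h).
  have := upper_congMr (phi h) (upper_congMl h^-1 (upper_cong_sym ux)).
  by rewrite /u mulKg mulVg.
by exists h; rewrite !mulgA mulgV mul1g mulgK.
Qed.

(** Starting from Z_c = G, the descent ends in Z_0 = 1. *)
Lemma twisted_conj1 x :
  finite_set (twisted_classes phi) -> twisted_conj phi x 1.
Proof.
move=> fin; have [c nil] := nilpotentG.
have [y -> //] : exists2 y, upper_cong 0 y 1 & twisted_conj phi x y.
move: (nil x 1) => {nil}; elim: c x => [|c IHc] x.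
  by move=> x1; exists x => //; apply: twisted_conj_refl.
move=> /(twisted_conj_descent _ _ fin)[y y1 xy].
have [z z1 yz] := IHc y y1; exists z => //.
exact: twisted_conj_trans yz.
Qed.

End UpperCentralCongruence.

Lemma reidemeister_number1 (G : groupType) (phi : {multiplicative G -> G}) :
  (forall x, twisted_conj phi x 1%g) -> reidemeister_number phi = Some 1.
Proof.
move=> phi1.
have classE x : [set y | twisted_conj phi y x] = setT.
  apply/seteqP; split=> // y _ /=; apply: twisted_conj_trans (phi1 y) _.
  have [z xz] := phi1 x; exists z^-1%g.
  by rewrite xz multiplicativeV invgK mulg1 mulKg mulVg.
have classesE : twisted_classes phi = [set setT] :> set (set G).
  apply/seteqP; split=> [_ [x ->]|_ ->] /=; first exact: classE.
  by exists 1%g; rewrite classE.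
by rewrite /reidemeister_number classesE fset_set1 cardfs1 asboolT.
Qed.

(** * The diagonal filtration of the unitriangular group *)

Section Bands.
Variables (R : fieldType) (n : nat).
Local Open Scope ring_scope.
Implicit Types (A B E : 'M[R]_n) (x y z g : UT R n) (d m : nat).

(** The first nonzero diagonal of A is at distance at least d above the main
    one; d = 0 is upper triangularity, and d = 1 strict upper triangularity. *)
Definition band d A := forall i j : 'I_n, (j < i + d)%N -> A i j = 0.

Lemma band_le d d' A : (d <= d')%N -> band d' A -> band d A.
Proof.
by move=> dd' hA i j ji; apply: hA; rewrite (leq_trans ji) ?leq_add2l.
Qed.

Lemma band_full A : band n A -> A = 0.
Proof.
move=> hA; apply/matrixP => i j; rewrite mxE.
by apply: hA; rewrite (leq_trans (ltn_ord j)) ?leq_addl.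
Qed.

Lemma bandD d A B : band d A -> band d B -> band d (A + B).
Proof. by move=> hA hB i j ji; rewrite mxE hA ?hB ?addr0. Qed.

Lemma bandN d A : band d A -> band d (- A).
Proof. by move=> hA i j ji; rewrite mxE hA ?oppr0. Qed.

Lemma bandB d A B : band d A -> band d B -> band d (A - B).
Proof. by move=> hA /bandN; apply: bandD. Qed.

Lemma bandZ d a A : band d A -> band d (a *: A).
Proof. by move=> hA i j ji; rewrite mxE hA ?mulr0. Qed.

Lemma bandM d d' A B : band d A -> band d' B -> band (d + d') (A *m B).
Proof.
move=> hA hB i j ji; rewrite mxE big1 // => k _.
have [ki|ik] := ltnP k (i + d); first by rewrite hA ?mul0r.
by rewrite hB ?mulr0 // (leq_trans ji) // addnA leq_add2r.
Qed.

Lemma band_unitriangularP A : band 1 (A - 1%:M) <-> unitriangular A.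
Proof.
split=> [hA | /unitriangularP hA i j]; last first.
  by rewrite addn1 ltnS => ji; rewrite !mxE hA ?subrr.
apply/unitriangularP => i j ji; apply/eqP; rewrite -subr_eq0.
by have := hA i j; rewrite addn1 ltnS !mxE => ->.
Qed.

Lemma UT_band1 x : band 1 (UT_mx x - 1%:M).
Proof. exact/band_unitriangularP/UT_mxP. Qed.

Lemma UT_band1B x y : band 1 (UT_mx x - UT_mx y).
Proof.
by have := bandB _ _ _ (UT_band1 x) (UT_band1 y); rewrite opprB addrA subrK.
Qed.

Lemma UT_band0 x : band 0 (UT_mx x).
Proof.
rewrite -[UT_mx x](subrK 1%:M); apply: bandD.
  exact: band_le (UT_band1 x).
by move=> i j; rewrite addn0 mxE => ji; rewrite -val_eqE /= gtn_eqF.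
Qed.

Lemma UT_addE x d E : (0 < d)%N -> band d E ->
  exists y, UT_mx y = UT_mx x + E.
Proof.
move=> d_gt0 hE; have uE : unitriangular (UT_mx x + E).
  apply/band_unitriangularP; rewrite addrAC; apply: bandD (UT_band1 x) _.
  exact: band_le hE.
by exists (MkUT uE).
Qed.

(** Newton-like solution of F x = 0: since at most n diagonals are nonzero, an
    equation that can be corrected on one more diagonal at each step has an
    exact solution. *)
Lemma UT_successive_approximation (F : UT R n -> 'M[R]_n) :
    band 1 (F 1%g) ->
    (forall d x, (0 < d)%N -> band d (F x) ->
       exists2 E, band d E &
         forall y, UT_mx y = UT_mx x + E -> band d.+1 (F y)) ->
  exists x, F x = 0.
Proof.
move=> F1 step; have approx d : exists x, band d.+1 (F x).
  elim: d => [|d [x hx]]; first by exists 1%g.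
  have [//|E hE FE] := step d.+1 x _ hx.
  by have [//|y yE] := UT_addE x d.+1 E _ hE; exists y; apply: FE.
have [x hx] := approx n; exists x.
by apply: band_full; apply: band_le hx.
Qed.

Lemma UT_expS x m : UT_mx (x ^+ m.+1)%g = UT_mx x *m UT_mx (x ^+ m)%g.
Proof. by rewrite expgS. Qed.

(** To first order the m-th power map is multiplication by m: with D = y - x,
    all products of D with strictly upper triangular matrices go one diagonal
    further. *)
Lemma UT_exp_band x y d m : band d (UT_mx y - UT_mx x) ->
  band d.+1 (UT_mx (y ^+ m)%g - UT_mx (x ^+ m)%g
             - m%:R *: (UT_mx y - UT_mx x)).
Proof.
move=> xy; elim: m => [|m IHm].
  by rewrite !expg0 subrr scale0r subr0 => i j _; rewrite mxE.
set D := UT_mx y - UT_mx x in xy IHm *; rewrite !UT_expS.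
set P := UT_mx (x ^+ m)%g in IHm *; set Q := UT_mx (y ^+ m)%g in IHm *.
have -> : UT_mx y *m Q - UT_mx x *m P - m.+1%:R *: D =
    UT_mx x *m (Q - P - m%:R *: D) + (UT_mx x - 1%:M) *m (m%:R *: D)
    + D *m (Q - 1%:M).
  rewrite !(mulmxBr, mulmxBl) !mul1mx !mulmx1 -natr1 scalerDl scale1r /D.
  by apply/matrixP => i j; rewrite !mxE; ring.
apply: bandD; last by rewrite -[d.+1]addn1; apply: bandM (UT_band1 _).
apply: bandD; first by rewrite -[d.+1]add0n; apply: bandM (UT_band0 _) _.
by rewrite -[d.+1]add1n; apply: bandM (UT_band1 _) _; apply: bandZ.
Qed.

(** Conjugation by elements that are close is closer by one diagonal, because
    x a = g x and y b = g y give
    x (a - b) = (g - 1) (x - y) - (x - y) (b - 1). *)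
Lemma UT_conj_band x y g d : band d (UT_mx x - UT_mx y) ->
  band d.+1 (UT_mx (g ^ x)%g - UT_mx (g ^ y)%g).
Proof.
move=> xy; set a := UT_mx (g ^ x)%g; set b := UT_mx (g ^ y)%g.
have xa : UT_mx x *m a = UT_mx g *m UT_mx x.
  exact/esym/(congr1 (@UT_mx _ _) (conjgC g x)).
have yb : UT_mx y *m b = UT_mx g *m UT_mx y.
  exact/esym/(congr1 (@UT_mx _ _) (conjgC g y)).
have xab : UT_mx x *m (a - b) =
    (UT_mx g - 1%:M) *m (UT_mx x - UT_mx y)
    - (UT_mx x - UT_mx y) *m (b - 1%:M).
  rewrite !(mulmxBr, mulmxBl) !mul1mx !mulmx1 xa yb.
  by apply/matrixP => i j; rewrite !mxE; ring.
rewrite -[a - b](mulKmx (unitriangular_unit (UT_mxP x))) -[d.+1]add0n.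
apply: (bandM _ _ _ _ (UT_band0 x^-1%g)); rewrite xab; apply: bandB.
  by rewrite -[d.+1]add1n; apply: bandM (UT_band1 g) _.
by rewrite -[d.+1]addn1; apply: bandM (UT_band1 _).
Qed.

(** Each conjugation in the recursive definition of the congruence gains one
    diagonal, and n diagonals suffice for equality; unitriangular matrices start
    with agreement on the main one, whence nilpotency. *)
Lemma upper_cong_band x y k d : (n <= d + k)%N ->
  band d (UT_mx x - UT_mx y) -> upper_cong (UT R n) k x y.
Proof.
elim: k d x y => [|k IHk] d x y /= ndk xy.
  apply: val_inj; apply: subr0_eq; apply: band_full; apply: band_le xy.
  by rewrite -[d]addn0.
move=> g; apply: (IHk d.+1); first by rewrite addSnnS.
exact: UT_conj_band.
Qed.

Lemma UT_nilpotent : exists c, forall x y, upper_cong (UT R n) c x y.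
Proof.
by exists n => x y; apply: (upper_cong_band _ _ _ 1 (leqnSn n)) (UT_band1B x y).
Qed.

Hypothesis charR : [pchar R] =i pred0.

Lemma natr_inj : injective (fun m => m%:R : R).
Proof.
have /pcharf0P natr0 := charR.
have le_inj i j : (i <= j)%N -> i%:R = j%:R :> R -> i = j.
  move=> ij /eqP; rewrite eq_sym -subr_eq0 -natrB // natr0 subn_eq0 => ji.
  by apply/eqP; rewrite eqn_leq ij.
move=> i j; have [ij /(le_inj i j ij) //|/ltnW ji] := leqP i j.
by move/esym/(le_inj j i ji).
Qed.

Lemma natrS_neq0 m : m.+1%:R != 0 :> R.
Proof. by have /pcharf0P -> := charR. Qed.

(** Two m-th roots of the same element that agree up to one diagonal differ on
    the next one by D with m D = 0. *)
Lemma UT_root_inj m x y : (0 < m)%N -> (x ^+ m = y ^+ m)%g -> x = y.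
Proof.
move=> m_gt0 xy; have mR : m%:R != 0 :> R.
  by have /pcharf0P -> := charR; rewrite -lt0n.
have close d : band d.+1 (UT_mx x - UT_mx y).
  elim: d => [|d IHd]; first exact: UT_band1B.
  have := UT_exp_band _ _ _ m IHd; rewrite xy subrr sub0r.
  by move/bandN/(bandZ _ m%:R^-1); rewrite opprK scalerK.
apply: val_inj; apply: subr0_eq; apply: band_full.
exact: band_le (close n).
Qed.

Lemma UT_divisible m x : (0 < m)%N -> exists y, (y ^+ m = x)%g.
Proof.
move=> m_gt0; have mR : m%:R != 0 :> R.
  by have /pcharf0P -> := charR; rewrite -lt0n.
(* By the first-order expansion, adding E to y adds m E to y^m on the next
   diagonal; so E must be the m-th part of the error. *)
have [] := UT_successive_approximation (fun y => UT_mx (y ^+ m)%g - UT_mx x).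
- exact: UT_band1B.
- move=> d y d_gt0 hy; exists (m%:R^-1 *: (UT_mx x - UT_mx (y ^+ m)%g)).
    by rewrite -opprB; apply/bandZ/bandN.
  move=> y' yE.
  have yE' : UT_mx y' - UT_mx y = m%:R^-1 *: (UT_mx x - UT_mx (y ^+ m)%g).
    by rewrite yE addrC addKr.
  have := UT_exp_band y y' d m; rewrite yE' scalerA divff // scale1r.
  rewrite opprB addrA subrK; apply.
  by rewrite -opprB; apply/bandZ/bandN.
by move=> y /subr0_eq/val_inj yx; exists y.
Qed.

(** * An automorphism with a single twisted class *)

(** Conjugation by diag(1, ..., n): in characteristic zero, 1, ..., n are
    nonzero and pairwise distinct in R. *)
Definition diag_scale_mx A : 'M[R]_n :=
  \matrix_(i, j) (i.+1%:R * A i j / j.+1%:R).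

Lemma diag_scale_unitriangular x : unitriangular (diag_scale_mx (UT_mx x)).
Proof.
apply/unitriangularP => i j ji; rewrite mxE.
have /unitriangularP/(_ i j ji) -> := UT_mxP x.
case: eqP => [->|_]; last by rewrite mulr0 mul0r.
by rewrite mulr1 divff ?natrS_neq0.
Qed.

Definition diag_scale x := MkUT (diag_scale_unitriangular x).

Lemma diag_scaleM : {morph diag_scale : x y / (x * y)%g}.
Proof.
move=> x y; apply/val_inj/matrixP => i j; rewrite !mxE /= mulr_sumr mulr_suml.
by apply: eq_bigr => k _; rewrite !mxE !mulrA divfK ?natrS_neq0.
Qed.

HB.instance Definition _ :=
  isMultiplicative.Build (UT R n) (UT R n) diag_scale diag_scaleM.

Lemma diag_scale_bij : bijective diag_scale.
Proof.
have scaleK (a b c : R) : a != 0 -> b != 0 -> a * (b * c / a) / b = c.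
  by move=> a0 b0; field; apply/andP.
have uV x : unitriangular
    (\matrix_(i, j) (j.+1%:R * UT_mx x i j / i.+1%:R) : 'M[R]_n).
  apply/unitriangularP => i j ji; rewrite mxE.
  have /unitriangularP/(_ i j ji) -> := UT_mxP x.
  case: eqP => [->|_]; last by rewrite mulr0 mul0r.
  by rewrite mulr1 divff ?natrS_neq0.
exists (fun x => MkUT (uV x)) => x; apply/val_inj/matrixP => i j;
  by rewrite !mxE scaleK ?natrS_neq0.
Qed.

(** x = z phi(z)^-1 reads z = x phi(z).  To first order, adding E to z adds
    E - phi(E) to z - x phi(z), and E |-> E - phi(E) is diagonal and invertible
    on the entries above the main diagonal. *)
Lemma diag_scale_twisted_conj1 x : twisted_conj diag_scale x 1%g.
Proof.
have [] := UT_successive_approximation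
  (fun z => UT_mx z - UT_mx (x * diag_scale z)%g).
- exact: UT_band1B.
- move=> d z d_gt0 hD; set D := UT_mx z - _ in hD.
  have [E EE] : exists E : 'M[R]_n,
      forall i j, E i j = D i j / (i.+1%:R / j.+1%:R - 1).
    by eexists (\matrix_(i, j) _) => i j; rewrite mxE.
  have hE : band d E by move=> i j ji; rewrite EE hD ?mul0r.
  exists E => // y yE.
  have hSE : band d (diag_scale_mx E).
    by move=> i j ji; rewrite mxE hE // mulr0 mul0r.
  have DE : D + E - diag_scale_mx E = 0.
    rewrite {}/D in hD EE *; move: (UT_mx z - _) => D in hD EE *.
    apply/matrixP => i j; rewrite !mxE EE.
    have [->|ij] := eqVneq i j.
      have jj : (j < j + d)%N by rewrite -[X in (X < _)%N]addn0 ltn_add2l.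
      by rewrite hD // !(mul0r, mulr0) addr0 subr0.
    have ijR : i.+1%:R - j.+1%:R != 0 :> R.
      by rewrite subr_eq0 (inj_eq natr_inj) eqSS.
    move: (natrS_neq0 j) ijR; move: (i.+1%:R) (j.+1%:R) => a b b0 ab0.
    by field; rewrite b0 mulN1r.
  have -> : UT_mx y - UT_mx (x * diag_scale y)%g =
      (D + E - diag_scale_mx E) - (UT_mx x - 1%:M) *m diag_scale_mx E.
    rewrite /D /= yE.
    have -> : diag_scale_mx (UT_mx z + E) =
        diag_scale_mx (UT_mx z) + diag_scale_mx E.
      by apply/matrixP => i j; rewrite !mxE mulrDr mulrDl.
    rewrite mulmxDr mulmxBl mul1mx.
    by apply/matrixP => i j; rewrite !mxE; ring.
  rewrite DE sub0r; apply: bandN; rewrite -[d.+1]add1n.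
  exact: bandM (UT_band1 x) hSE.
move=> z /subr0_eq/val_inj zE; exists z.
by rewrite mulg1 [X in (X * _)%g]zE mulgK.
Qed.

End Bands.

(** * The spectrum *)

Theorem theorem2 (R : fieldType) (n : nat)
    (charR : [pchar R]%R =i pred0) (hn : 3 <= n) :
  reidemeister_spectrum (UT R n) = [set Some 1; None].
Proof.
have dichotomy (phi : {multiplicative UT R n -> UT R n}) x :
    finite_set (twisted_classes phi) -> twisted_conj phi x 1%g.
  apply: twisted_conj1.
  - by move=> m y; apply: UT_divisible.
  - by move=> m y z; apply: UT_root_inj.
  - exact: UT_nilpotent.
apply/seteqP; split=> [_ [phi _ ->]|_ [|] ->] /=.
- rewrite /reidemeister_number; case: asboolP => fin; last by right.
  left; rewrite -(reidemeister_number1 _ phi) => [|x]; last exact: dichotomy.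
  by rewrite /reidemeister_number asboolT.
- exists (diag_scale R n charR); first exact: diag_scale_bij.
  by rewrite reidemeister_number1 // => x; apply: diag_scale_twisted_conj1.
exists idfun; first by exists idfun.
rewrite /reidemeister_number asboolF // => /(dichotomy idfun) id1.
have n_gt0 := ltn_trans (isT : 0 < 2) hn.
(* The transvection 1 + E would be conjugate, hence equal, to 1. *)
pose E : 'M[R]_n := delta_mx (Ordinal n_gt0) (Ordinal (ltnW hn)).
have [//||x xE] := UT_addE R n 1%g 1 E.
  by move=> i j; rewrite addn1 ltnS mxE; do 2!case: eqP => //= ->.
have [z] := id1 x.
rewrite /= mulg1 mulgV => x1; move: xE; rewrite x1.
move/(congr1 (fun A : 'M[R]_n => A (Ordinal n_gt0) (Ordinal (ltnW hn)))).
by rewrite !mxE !eqxx /= add0r => /esym/eqP; rewrite oner_eq0.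
Qed.
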